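(* Let $(X,d)$ be an unbounded metric space. For a subset $Y$ of $X$, the following statements hold: (i) $Y$ is thick if and only if there exists $p\in X^\#$ such that $\overline{\overline{p}} = \bigtriangleup_p(Y)$; (ii) $Y$ is prethick if and only if there exist $p\in X^\#$ and $r\geqslant 0$ such that $\overline{\overline{p}} = \bigtriangleup_p(B(Y,r))$; (iii) $Y$ is small if and only if, for every $p\in X^\#$ and each $r\geqslant 0$, $\overline{\overline{p}} \ne \bigtriangleup_p(B(Y,r))$.
   Context: For $x\in X$, $r\geqslant 0$, $A\subseteq X$: $B(x,r)=\{y\in X: d(x,y)\leqslant r\}$ and $B(A,r)=\bigcup_{a\in A}B(a,r)$. A subset $V\subseteq X$ is bounded if $V\subseteq B(x,r)$ for some $x\in X$, $r\geqslant 0$. A subset $Y\subseteq X$ is - large if $X=B(Y,r)$ for some $r\geqslant 0$; - thick if for every $r\geqslant 0$ there exists $y\in Y$ such that $B(y,r)\subseteq Y$; - prethick if $B(Y,r)$ is thick for some $r\geqslant 0$; - small if $(X\setminus Y)\cap L$ is large for every large subset $L$ of $X$. $\beta X$ denotes the set of all ultrafilters on $X$ (the Stone-Čech compactification of $X$ with the discrete topology). For $Y\subseteq X$, $Y^\#=\{p\in\beta X: Y\in p \text{ and each } P\in p \text{ is unbounded in } X\}$; in particular $X^\#$ is the set of all ultrafilters on $X$ all of whose members are unbounded. For $p,q\in X^\#$ write $p\parallel q$ if there is $r\geqslant 0$ such that $B(Q,r)\in p$ for each $Q\in q$ (this is an equivalence relation, called parallel equivalence). Put $\overline{\overline{p}}=\{q\in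 X^\#: p\parallel q\}$ and, for $Y\subseteq X$, $\bigtriangleup_p(Y)=\overline{\overline{p}}\cap Y^\#$. *)

(* Defs.v *)
From HB Require Import structures.
From mathcomp Require Import all_boot all_order all_algebra.
From mathcomp Require Import all_classical all_reals topology.

Set Implicit Arguments.
Unset Strict Implicit.
Unset Printing Implicit Defensive.

Import Order.TTheory GRing.Theory Num.Theory.

Local Open Scope classical_set_scope.
Local Open Scope ring_scope.

Section LargeScale.
Context {R : realType} {X : metricType R}.
Implicit Types (x : X) (r : R) (A V Y : set X) (p q : set_system X).

(* The library's [ball] is the open ball, and its [closed_ball] is the closure
   of the open ball, which may be strictly smaller than this set. *)
Definition cball x r : set X := [set y | mdist x y <= r].

Definition set_cball A r : set X := \bigcup_(a in A) cball a r.

(* Metric boundedness; [bounded_set] of the library is only for normed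
   modules. *)
Definition mbounded V : Prop := exists x r, 0 <= r /\ V `<=` cball x r.

Definition large Y : Prop := exists r, 0 <= r /\ [set: X] = set_cball Y r.

Definition thick Y : Prop :=
  forall r, 0 <= r -> exists y, Y y /\ cball y r `<=` Y.

Definition prethick Y : Prop := exists r, 0 <= r /\ thick (set_cball Y r).

Definition small Y : Prop := forall L : set X, large L -> large (~` Y `&` L).

(* Y^#; points of the Stone-Cech compactification of the discrete X are
   represented as the set systems satisfying [UltraFilter]. *)
Definition sharp Y : set (set_system X) :=
  [set p | [/\ UltraFilter p, p Y & forall P, p P -> ~ mbounded P]].

Definition parallel p q : Prop :=
  exists r, 0 <= r /\ forall Q, q Q -> p (set_cball Q r).

Definition parallel_class p : set (set_system X) :=
  [set q | sharp [set: X] q /\ parallel p q].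

Definition triangle p Y : set (set_system X) := parallel_class p `&` sharp Y.

End LargeScale.

(* Main.v *)
(**
  A set is thick iff its complement is not large. If the complement of [Y] is
  large, moving each point to a nearby point outside [Y] pushes any [p]
  forward to a parallel ultrafilter that avoids [Y]. If [Y] is thick, the sets
  of far away points [y] with [B(y, r) ⊆ Y] generate a filter; for an
  ultrafilter [p] above it, no [Q] disjoint from [Y] can have [B(Q, r)] in [p],
  so every ultrafilter parallel to [p] contains [Y]. Part (iii) follows from
  (ii), because the small sets are exactly those that are not prethick.
*)
Require Import Defs.
From mathcomp Require Import all_boot all_order all_algebra.
From mathcomp Require Import all_classical all_reals topology.
From mathcomp Require Import lra.

Local Open Scope classical_set_scope.
Local Open Scope ring_scope.

Import Order.TTheory GRing.Theory Num.Theory.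

Lemma fmap_ultra (T U : Type) (f : T -> U) (p : set_system T) :
  UltraFilter p -> UltraFilter (f @ p).
Proof.
move=> pU; split=> [|G GF pG]; first exact: fmap_proper_filter.
apply/seteqP; split=> [A GA|A /pG//].
have [//|pC] := in_ultra_setVsetC (f @^-1` A) pU.
have GC : G (~` A) by exact: (pG _ pC).
by have [x [Ax]] := filter_ex (filterI GA GC).
Qed.

Section LargeScale.
Set Implicit Arguments.
Unset Strict Implicit.
Context {R : realType} {X : metricType R}.
Implicit Types (x y : X) (r s : R) (A L V Y : set X) (p : set_system X).

Lemma sub_set_cball A r : 0 <= r -> A `<=` set_cball A r.
Proof. by move=> r0 x Ax; exists x => //; rewrite /cball/= mdistxx. Qed.

Lemma mbounded_set_cball V r : 0 <= r -> mbounded V -> mbounded (set_cball V r).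
Proof.
move=> r0 [x [s [s0 Vs]]]; exists x, (s + r); split; first exact: addr_ge0.
move=> z [v /Vs xv vz]; rewrite /cball/= in xv vz *.
by have := metric_triangle x v z; lra.
Qed.

(** By symmetry of the distance, a point escapes the [r]-neighbourhood of the complement exactly
    when its [r]-ball stays inside [Y]. *)
Lemma thickP Y : thick Y <-> ~ large (~` Y).
Proof.
split=> [tY [r [r0 YE]]|nl r r0].
  have [y [_ yY]] := tY r r0.
  have [z nYz] : set_cball (~` Y) r y by rewrite -YE.
  by rewrite /cball/= metric_sym => /yY.
apply: contrapT => nY; apply: nl; exists r; split => //.
apply/seteqP; split=> // x _; apply: contrapT => nx; apply: nY; exists x.
have xrY : cball x r `<=` Y.
  move=> z xz; apply: contrapT => nYz; apply: nx; exists z => //.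
  by rewrite /cball/= metric_sym.
by split => //; apply: xrY; rewrite /cball/= mdistxx.
Qed.

Lemma smallP Y : small Y <-> ~ prethick Y.
Proof.
split=> [sY [r [r0 tY]]|npY L [s [s0 LE]]].
  (* Deleting [Y] from this large set leaves only points outside [set_cball Y r], so the complement
     of a thick set would be large. *)
  have /sY : large (Y `|` ~` set_cball Y r).
    exists r; split => //; apply/seteqP; split=> // x _.
    have [[y Yy yx]|nx] := pselect (set_cball Y r x); first by exists y => //; left.
    by apply: sub_set_cball => //; right.
  rewrite setIUr setICl set0U => -[s [s0 sE]].
  case/thickP: tY; exists s; split => //; apply/seteqP; split=> // x _.
  by have [z [_ nz] zx] : set_cball (~` Y `&` ~` set_cball Y r) s x;
    [rewrite -sE | exists z].
apply: contrapT => nl; apply: npY; exists s; split => // r r0.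
(* The radius [r + s] is chosen so that, for [w] in the [r]-ball of [z], any point of [L] within [s]
   of [w] must lie in [Y]. *)
have [z nz] : exists z, ~ set_cball (~` Y `&` L) (r + s) z.
  apply: contrapT => nz; apply: nl; exists (r + s); split; first exact: addr_ge0.
  by apply/seteqP; split=> // x _; apply: contrapT => nx; apply: nz; exists x.
have zrY : cball z r `<=` set_cball Y s.
  move=> w zw; have [l Ll lw] : set_cball L s w by rewrite -LE.
  exists l => //; apply: contrapT => nYl; apply: nz; exists l => //.
  rewrite /cball/= in zw lw *.
  by have := metric_triangle l w z; rewrite [mdist w z]metric_sym; lra.
by exists z; split => //; apply: zrY; rewrite /cball/= mdistxx.
Qed.

(** Members of the class are already ultrafilters of unbounded sets, so [sharp Y] only adds the
    condition [q Y]. *)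
Lemma parallel_class_subP p Y :
  parallel_class p = triangle p Y <-> forall q, parallel_class p q -> q Y.
Proof.
split=> [pE q|pY]; first by rewrite pE => -[_ []].
apply/seteqP; split=> [q pq|q []//].
by split=> //; have [[qU _ qub] _] := pq; split => //; exact: pY.
Qed.

Lemma large_parallel p A : sharp [set: X] p -> large A ->
  exists2 q, parallel_class p q & q A.
Proof.
move=> [pU pT pub] [r [r0 AE]].
have /choice[f fP] x : exists y, A y /\ cball y r x.
  have [y Ay yx] : set_cball A r x by rewrite -AE.
  by exists y.
(* As [f] moves points by at most [r], this gives both that [p] is parallel to [f @ p] and that
   members of [f @ p] are unbounded. *)
have ppar Q : p (f @^-1` Q) -> p (set_cball Q r).
  by apply: filterS => x Qfx; exists (f x) => //; have [] := fP x.
have pA : p (f @^-1` A) by apply: filterS pT => x _; have [] := fP x.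
exists (f @ p) => //.
split; last by exists r.
split=> [||Q /ppar/pub nb bQ]; first exact: fmap_ultra.
- exact: filterT.
- exact/nb/mbounded_set_cball.
Qed.

Lemma thick_deep_point Y x r : ~ mbounded [set: X] -> thick Y -> 0 <= r ->
  exists y, cball y r `<=` Y /\ r < mdist x y.
Proof.
move=> Xub tY r0; have [z xz] : exists z, r < mdist x z.
  apply: contrapT => nz; apply: Xub; exists x, r; split => // z _.
  by rewrite /cball/= leNgt; apply/negP => xz; apply: nz; exists z.
(* If [y] turns out to be within [r] of [x], this radius suffices for its ball to contain the
   [r]-ball of the far point [z]. *)
have [|y [_ yY]] := tY (mdist x z + 2 * r); first by lra.
have [xy|yx] := ltP r (mdist x y).
  by exists y; split => // w yw; apply: yY; rewrite /cball/= in yw *; lra.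
exists z; split => // w zw; apply: yY; rewrite /cball/= in zw *.
have := metric_triangle y z w; have := metric_triangle y x z.
by rewrite [mdist y x]metric_sym; lra.
Qed.

Lemma thick_deep_ultrafilter Y : ~ mbounded [set: X] -> thick Y ->
  exists2 p, sharp [set: X] p &
    forall r, 0 <= r -> p [set y | cball y r `<=` Y].
Proof.
move=> Xub tY; have [x _] := tY 0 (lexx 0).
(* The distance condition forces every member of an ultrafilter containing all [D r] to be
   unbounded. *)
pose D r := [set y | cball y r `<=` Y /\ r < mdist x y].
have DS r s : r <= s -> D s `<=` D r.
  move=> rs y [yY sy]; split; last exact: le_lt_trans sy.
  by move=> z yz; apply: yY; exact: le_trans rs.
have F : ProperFilter (filter_from [set r : R | 0 <= r] D).
  apply: filter_from_proper => [|r r0]; last exact: thick_deep_point.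
  apply: filter_from_filter; first by exists 0 => /=.
  move=> r s /= r0 s0; exists (r + s); first exact: addr_ge0.
  by rewrite subsetI; split; apply: DS; lra.
have [p [pU Dp]] := ultraFilterLemma F.
have pD r : 0 <= r -> p (D r) by move=> r0; apply: Dp; exists r.
exists p => [|r /pD]; last by apply: filterS => y [].
split => //; first exact: filterT.
move=> P pP [z [s [s0 Ps]]].
have r0 : 0 <= mdist x z + s by rewrite addr_ge0// mdist_ge0.
have [y [/Ps zy [_ xy]]] := filter_ex (filterI pP (pD _ r0)).
by rewrite /cball/= in zy; have := metric_triangle x z y; lra.
Qed.

Lemma thick_parallel_class Y : ~ mbounded [set: X] ->
  thick Y <->
  exists p, sharp [set: X] p /\ parallel_class p = triangle p Y.
Proof.
move=> Xub; split=> [tY|[p [sp /parallel_class_subP pY]]].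
  have [p sp pY] := thick_deep_ultrafilter Xub tY.
  exists p; split => //; apply/parallel_class_subP => q [[qU _ _] [r [r0 pq]]].
  (* Otherwise the [r]-neighbourhood of the complement is in [p] and meets the set of points whose
     [r]-ball lies in [Y]. *)
  have [//|/pq pC] := in_ultra_setVsetC Y qU.
  have [pU _ _] := sp.
  have [y [[z nYz zy] yY]] := filter_ex (filterI pC (pY r r0)).
  by case: nYz; apply: yY; rewrite /cball/= metric_sym.
apply/thickP => /(large_parallel sp)[q pq qC].
have [[qU _ _] _] := pq.
by have [x [Yx]] := filter_ex (filterI (pY q pq) qC).
Qed.

Lemma prethick_parallel_class Y : ~ mbounded [set: X] ->
  prethick Y <->
  exists p r, [/\ sharp [set: X] p, 0 <= r &
    parallel_class p = triangle p (set_cball Y r)].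
Proof.
move=> Xub; split=> [[r [r0 /(thick_parallel_class _ Xub)[p [sp pE]]]]|].
  by exists p, r.
move=> [p [r [sp r0 pE]]]; exists r; split => //.
by apply/(thick_parallel_class _ Xub); exists p.
Qed.

End LargeScale.

Theorem theorem4p2 (R : realType) (X : metricType R)
    (X_unbounded : ~ mbounded [set: X]) (Y : set X) :
  [/\ thick Y <->
        (exists p : set_system X,
           sharp [set: X] p /\ parallel_class p = triangle p Y),
      prethick Y <->
        (exists (p : set_system X) (r : R),
           [/\ sharp [set: X] p, 0 <= r &
               parallel_class p = triangle p (set_cball Y r)])
    & small Y <->
        (forall (p : set_system X) (r : R),
           sharp [set: X] p -> 0 <= r ->
           parallel_class p <> triangle p (set_cball Y r))].
Proof.
split; [exact: thick_parallel_class|exact: prethick_parallel_class|].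
rewrite smallP prethick_parallel_class//; split=> [np p r sp r0 pE|np].
  by apply: np; exists p, r.
by move=> [p [r [sp r0]]]; exact: np.
Qed.
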